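(* Let $n \geq 3$ and let $\mathcal{S}_n^0 \subseteq \mathbb{C}^{n\times n}$ be the affine variety of $n\times n$ traceless symmetric matrices. Then $\mathbf{FL}_{\mathrm{gen}}(\mathcal{S}_n^0) = 2$ and $\mathbf{FL}_{\mathrm{max}}(\mathcal{S}_n^0) \leq 10$.
   Context: For an affine variety $X \subseteq \mathbb{C}^{n\times n}$ and an integer $r \geq 1$, let $\mu_r^0(X) = \{M_1\cdots M_r : M_1,\dots,M_r \in X\}$ and let $\mu_r(X)$ be the Zariski closure of $\mu_r^0(X)$ in $\mathbb{C}^{n\times n}$. Define $\mathbf{FL}_{\mathrm{max}}(X) = \min\{r \geq 1 : \mu_r^0(X) = \mathbb{C}^{n\times n}\}$ and $\mathbf{FL}_{\mathrm{gen}}(X) = \min\{r \geq 1 : \mu_r(X) = \mathbb{C}^{n\times n}\}$. Symmetric means $M^T = M$, and traceless means that the trace is $0$. *)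

(* Defs.v *)
From HB Require Import structures.
From mathcomp Require Import all_boot all_order all_algebra.
From mathcomp Require Import boolp classical_sets reals complex.
From mathcomp Require Import mpoly.

Set Implicit Arguments.
Unset Strict Implicit.
Unset Printing Implicit Defensive.

Import GRing.Theory.
Local Open Scope classical_set_scope.
Local Open Scope ring_scope.

Section FactorizationLength.
Variables (K : fieldType) (n : nat).

(* [mxvec] flattens the n * n entries of A, which serve as the coordinates. *)
Definition zero_locus (I : set {mpoly K[n * n]}) : set 'M[K]_n :=
  [set A | forall p, I p -> p.@[fun k => mxvec A 0 k] = 0].

Definition zariski_closed (Z : set 'M[K]_n) : Prop :=
  exists I : set {mpoly K[n * n]}, Z = zero_locus I.

Definition zariski_closure (S : set 'M[K]_n) : set 'M[K]_n :=
  [set A | forall Z, zariski_closed Z -> S `<=` Z -> Z A].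

Definition mu0 (r : nat) (X : set 'M[K]_n) : set 'M[K]_n :=
  [set A | exists2 M : 'I_r -> 'M[K]_n,
     (forall i, X (M i)) & A = \big[mulmx/1%:M]_(i < r) M i].

Definition mu (r : nat) (X : set 'M[K]_n) : set 'M[K]_n :=
  zariski_closure (mu0 r X).

(* The minimum need not exist for arbitrary X, so the factorization lengths
   are given as relations: each holds for at most one value of l. *)
Definition is_minimum (P : set nat) (l : nat) : Prop :=
  P l /\ (forall r, P r -> (l <= r)%N).

Definition is_FL_max (X : set 'M[K]_n) (l : nat) : Prop :=
  is_minimum [set r | (1 <= r)%N /\ mu0 r X = setT] l.

Definition is_FL_gen (X : set 'M[K]_n) (l : nat) : Prop :=
  is_minimum [set r | (1 <= r)%N /\ mu r X = setT] l.

Definition traceless_symmetric : set 'M[K]_n :=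
  [set A | A^T = A /\ \tr A = 0].

End FactorizationLength.

Arguments traceless_symmetric : clear implicits.

(* Main.v *)
From HB Require Import structures.
Require Import Defs.
From mathcomp Require Import all_boot all_order all_algebra.
From mathcomp Require Import boolp classical_sets reals complex separable.
From mathcomp Require Import mpoly.
From mathcomp Require Import ring.

Set Implicit Arguments.
Unset Strict Implicit.
Unset Printing Implicit Defensive.

Import GRing.Theory Num.Theory.
Local Open Scope ring_scope.

(** Write S for the space of traceless symmetric matrices of size n >= 3.

    Let A = P D P^-1 with D diagonal and invertible.  For every invertible
    diagonal E the matrix A is the product of the two symmetric matrices
    P E P^T and P^-T (E^-1 D) P^-1, and their traces are
    sum_i e_i (P^T P)_ii and sum_i (d_i / e_i) (P^-1 P^-T)_ii.  Both vanish for
    a suitable E as soon as n >= 3 and no diagonal entry of P^T P and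
    P^-1 P^-T is zero, that is, as soon as A and A^T have bases of
    nonisotropic eigenvectors: this is [reciprocal_system], where a quadratic
    equation is solved over an algebraically closed field.  So A is in S.S
    ([nonisotropic_mu0_2]).

    This condition on A follows from the nonvanishing of one polynomial
    [eigen_discr] in the entries of A ([eigen_discr_neq0]), and that polynomial
    does not vanish at diagonal matrices with distinct nonzero entries.  So
    on any line through such a diagonal matrix, all but finitely many points
    are in S.S.  Three consequences follow.
    - A polynomial vanishing on S.S vanishes on all these lines, hence
      everywhere, and S.S is Zariski dense ([mu_2_full]), whereas S itself is
      contained in the hyperplane of trace zero.
    - Given an invertible A, move B along a line from A^-1 W to W, with W
      diagonal as above: for some B on the line both A B and B satisfy the
      condition, which is stable under inversion, so that A = (A B) B^-1 is a
      product of four elements of S ([unitmx_mu0_4]).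
    - Every rank is attained in S ([traceless_symmetric_rank]), and two
      matrices of the same rank differ by invertible factors on both sides.
      Therefore every matrix is a product of 4 + 1 + 4 = 9 elements of S. *)

(** * Products of elements of a set of matrices *)

HB.instance Definition _ (R : pzSemiRingType) (n : nat) :=
  Monoid.isLaw.Build 'M[R]_n 1%:M (@mulmx R n n n)
    (@mulmxA R n n n n) (@mul1mx R n n) (@mulmx1 R n n).

Lemma mu0_1 (F : fieldType) n (Y : set 'M[F]_n) (A : 'M[F]_n) :
  Y A -> mu0 1 Y A.
Proof. by move=> YA; exists (fun=> A) => //; rewrite big_ord1. Qed.

Lemma mu0_mul (F : fieldType) n r s (Y : set 'M[F]_n) (A B : 'M[F]_n) :
  mu0 r Y A -> mu0 s Y B -> mu0 (r + s) Y (A *m B).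
Proof.
move=> [M YM ->] [N YN ->].
exists (fun i => match split i with inl j => M j | inr k => N k end).
  by move=> i; case: (split i).
rewrite big_split_ord /=; congr (_ *m _); apply: eq_bigr => i _.
  by rewrite (unsplitK (inl _ i)).
by rewrite (unsplitK (inr _ i)).
Qed.

(** * Two reciprocal linear equations *)

Lemma poly_nonroot (C : numClosedFieldType) (p : {poly C}) :
  p != 0 -> exists t, p.[t] != 0.
Proof.
move=> p0; apply: contrapT => H.
have inj : injective (fun i : nat => i%:R : C).
  by move=> i j /eqP; rewrite eqr_nat => /eqP.
have := @max_poly_roots _ p [seq i%:R | i <- iota 0 (size p)] p0.
rewrite size_map size_iota ltnn map_inj_uniq ?iota_uniq// => /(_ _ isT) H'.
suff: false by [].
apply: H'; apply/allP => _ /mapP[i _ ->]; apply/rootP/eqP/negP => /negP ti.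
by apply: H; exists i%:R.
Qed.

(** Eliminating y leaves a quadratic equation in x.  Its leading and constant
    coefficients are - r a1 and - b1 s, so that it has a root and no root is
    zero. *)
Lemma reciprocal_pair (C : numClosedFieldType) (a1 a2 s b1 b2 r : C) :
    a1 != 0 -> a2 != 0 -> s != 0 -> b1 != 0 -> b2 != 0 -> r != 0 ->
  exists x y, [/\ x != 0, y != 0, a1 * x + a2 * y + s = 0
                & b1 / x + b2 / y + r = 0].
Proof.
move=> a10 a20 s0 b10 b20 r0.
pose p : {poly C} :=
  Poly [:: - (b1 * s); a2 * b2 - b1 * a1 - r * s; - (r * a1)].
have sp : size p = 3.
  by rewrite /p (@PolyK _ 1)//= oppr_eq0 mulf_neq0.
have /closed_rootP[x /rootP] : size p != 1 by rewrite sp.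
rewrite horner_Poly /= => px.
have x0 : x != 0.
  apply/eqP => x0; move: px; rewrite x0 !mulr0 add0r => /eqP.
  by rewrite oppr_eq0 mulf_eq0 (negPf b10) (negPf s0).
pose y := - (a1 * x + s) / a2.
have ya : a2 * y = - (a1 * x + s) by rewrite /y mulrCA mulfV// mulr1.
have key : b1 * y + b2 * x + r * x * y = 0.
  apply/(mulfI a20); rewrite mulr0 -px.
  have -> : a2 * (b1 * y + b2 * x + r * x * y)
            = b1 * (a2 * y) + a2 * b2 * x + r * x * (a2 * y) by ring.
  by rewrite ya; ring.
have y0 : y != 0.
  apply/eqP => y0; move: key; rewrite y0 !mulr0 add0r addr0 => /eqP.
  by rewrite mulf_eq0 (negPf b20) (negPf x0).
exists x, y; split=> //; first by rewrite ya; ring.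
by apply: (mulIf (mulf_neq0 x0 y0)); rewrite mul0r -key; field; rewrite x0 y0.
Qed.

(** The case of two unknowns with nonzero constant terms is [reciprocal_pair];
    a third unknown is what makes it possible to have these constant terms
    nonzero. *)
Lemma reciprocal_system (C : numClosedFieldType) n (a b : 'I_n -> C) :
    (3 <= n)%N ->
    (forall i, a i != 0) -> (forall i, b i != 0) ->
  exists e : 'I_n -> C, [/\ forall i, e i != 0, \sum_i a i * e i = 0
                          & \sum_i b i / e i = 0].
Proof.
case: n a b => [|[|[|n]]]// a b _ a0 b0.
pose i0 : 'I_n.+3 := ord0; pose i1 : 'I_n.+3 := lift ord0 ord0.
pose i2 : 'I_n.+3 := lift ord0 (lift ord0 ord0).
pose k (i : 'I_n) : 'I_n.+3 := lift ord0 (lift ord0 (lift ord0 i)).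
pose s' := \sum_i a (k i); pose r' := \sum_i b (k i).
(* [z] is the third unknown, all the later ones being set to 1.  The roots of
   [p] are 0 and the values for which the constant term left in one
   of the two equations for the first two unknowns would be zero. *)
pose p := 'X * (a i2 *: 'X + s'%:P) * (r' *: 'X + (b i2)%:P).
have [z] : exists z, p.[z] != 0.
  apply: poly_nonroot; rewrite !mulf_neq0 ?polyX_eq0//.
    apply/eqP => /(congr1 (fun q : {poly C} => q`_1)) /eqP.
    by rewrite coefD coefZ coefX coefC coef0 /= mulr1 addr0 (negPf (a0 _)).
  apply/eqP => /(congr1 (fun q : {poly C} => q`_0)) /eqP.
  by rewrite coefD coefZ coefX coefC coef0 /= mulr0 add0r (negPf (b0 _)).
rewrite !hornerE /= !mulf_eq0 !negb_or => /andP[/andP[z0 sz] rz].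
have rz' : b i2 / z + r' != 0.
  apply: contra rz => /eqP rz'; apply/eqP.
  by rewrite -(mul0r z) -rz'; field.
have [x [y [x0 y0 xy1 xy2]]] :=
  reciprocal_pair (a0 i0) (a0 i1) sz (b0 i0) (b0 i1) rz'.
exists (fun i => nth 1 [:: x; y; z] i); split.
- by move=> [[|[|[|i]]] hi] //=; rewrite nth_nil oner_eq0.
- rewrite !big_ord_recl /= -[RHS]xy1 -!addrA; congr (_ + (_ + (_ + _))).
  by apply: eq_bigr => i _; rewrite nth_nil mulr1.
- rewrite !big_ord_recl /= -[RHS]xy2 -!addrA; congr (_ + (_ + (_ + _))).
  by apply: eq_bigr => i _; rewrite nth_nil divr1.
Qed.

(** * Matrices with nonisotropic eigenvectors *)

Section Nonisotropic.
Variables (C : numClosedFieldType) (n : nat).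

(** The diagonal entries of P^T P and P^-1 P^-T are the values of the standard
    quadratic form at the eigenvectors of A and of its transpose. *)
Definition nonisotropic (A : 'M[C]_n) :=
  exists P : 'M[C]_n, exists d : 'rV[C]_n,
  [/\ P \in unitmx, forall i, d 0 i != 0, forall i, (P^T *m P) i i != 0,
      forall i, (invmx P *m (invmx P)^T) i i != 0
    & A = P *m diag_mx d *m invmx P].

Lemma nonisotropic_inv A : nonisotropic A -> nonisotropic (invmx A).
Proof.
move=> [P [d [Pu d0 PP PP' ->]]]; exists P, (\row_i (d 0 i)^-1); split=> //.
  by move=> i; rewrite mxE invr_eq0.
have uD : diag_mx d *m diag_mx (\row_i (d 0 i)^-1) = 1%:M.
  rewrite mulmx_diag -diag_const_mx; congr diag_mx; apply/rowP => i.
  by rewrite !mxE mulfV.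
have E : (P *m diag_mx d *m invmx P)
           *m (P *m diag_mx (\row_i (d 0 i)^-1) *m invmx P) = 1%:M.
  by rewrite !mulmxA mulmxKV// -(mulmxA P) uD mulmx1 mulmxV//.
have [u _] := mulmx1_unit E.
by rewrite -[LHS]mulmx1 -E mulKmx.
Qed.

Lemma tr_diag_conj (P : 'M[C]_n) (d : 'rV[C]_n) :
  \tr (P *m diag_mx d *m P^T) = \sum_i (P^T *m P) i i * d 0 i.
Proof.
rewrite mxtrace_mulC mulmxA /mxtrace; apply: eq_bigr => i _.
by rewrite mul_mx_diag !mxE.
Qed.

(** The two factors are P E P^T and P^-T (E^-1 D) P^-1, where the diagonal
    matrix E is chosen so as to make both traces zero. *)
Lemma nonisotropic_mu0_2 A :
  (3 <= n)%N -> nonisotropic A -> mu0 2 (traceless_symmetric C n) A.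
Proof.
move=> n3 [P [d [Pu d0 PP PP' ->]]].
have [e [e0 sa sb]] := reciprocal_system n3 PP
  (fun i => mulf_neq0 (PP' i) (d0 i)).
pose E := \row_i e i; pose E' := \row_i (d 0 i / e i).
have -> : P *m diag_mx d *m invmx P
  = (P *m diag_mx E *m P^T) *m ((invmx P)^T *m diag_mx E' *m invmx P).
  rewrite !mulmxA; congr (_ *m _).
  rewrite -[_ *m P^T *m _]mulmxA -trmx_mul mulVmx// trmx1 mulmx1.
  rewrite -mulmxA mulmx_diag; congr (_ *m diag_mx _); apply/rowP => i.
  by rewrite !mxE mulrC divfK.
apply: (@mu0_mul _ _ 1 1); apply: mu0_1; split.
- by rewrite !trmx_mul trmxK tr_diag_mx mulmxA.
- by rewrite tr_diag_conj -[RHS]sa; apply: eq_bigr => i _; rewrite [E 0 i]mxE.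
- by rewrite !trmx_mul trmxK tr_diag_mx mulmxA.
- rewrite -[X in _ *m X]trmxK tr_diag_conj trmxK -[RHS]sb.
  by apply: eq_bigr => i _; rewrite [E' 0 i]mxE mulrA.
Qed.

End Nonisotropic.

(** * A polynomial condition for nonisotropic eigenvectors *)

(** At a simple eigenvalue d of A, with eigenvectors p of A and q of A^T, the
    adjugate of d - A is proportional to p q^T, so that the trace below takes at
    d a value proportional to (p^T p) (q^T q).  Evaluating a polynomial f at A
    and taking the determinant gives the product of the values of f at the
    eigenvalues: this expresses a condition on all the eigenvalues by a
    formula over any commutative ring, which can be specialized along
    polynomial families of matrices.  The definition is locked to keep
    unification from unfolding determinants over polynomial rings. *)
HB.lock Definition eigen_discr (R : comNzRingType) n' (A : 'M[R]_n'.+1) : R :=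
  let adjA := \adj (char_poly_mx A) in
  \det A * \det (horner_mx A ((char_poly A)^`() * \tr (adjA *m adjA^T))).

Lemma map_eigen_discr (R S : comNzRingType) (f : {rmorphism R -> S}) n'
  (A : 'M[R]_n'.+1) : eigen_discr (map_mx f A) = f (eigen_discr A).
Proof.
rewrite eigen_discr.unlock [RHS]rmorphM -!det_map_mx; congr (_ * \det _).
rewrite map_horner_mx; congr (horner_mx _ _); rewrite [RHS]rmorphM /=.
congr (_ * _).
  by rewrite -deriv_map map_char_poly.
by rewrite -map_char_poly_mx -map_mx_adj map_trmx -map_mxM trace_map_mx.
Qed.

Lemma char_poly_conj (F : fieldType) n' (P A : 'M[F]_n') : P \in unitmx ->
  char_poly (P *m A *m invmx P) = char_poly A.
Proof.
move=> Pu; rewrite /char_poly.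
have -> : char_poly_mx (P *m A *m invmx P) =
    map_mx polyC P *m char_poly_mx A *m map_mx polyC (invmx P).
  rewrite /char_poly_mx !map_mxM mulmxBr mulmxBl scalar_mxC; congr (_ - _).
  by rewrite -mulmxA -map_mxM mulmxV// map_mx1 mulmx1.
rewrite !det_mulmx mulrAC -det_mulmx -map_mxM mulmxV// map_mx1 det1 mul1r //.
Qed.

Lemma det_horner_common_root (F : fieldType) n' (A : 'M[F]_n'.+1)
    (p : {poly F}) a :
  root (char_poly A) a -> root p a -> \det (horner_mx A p) = 0.
Proof.
rewrite -eigenvalue_root_char => /eigenvalueP[v vA v0] /factor_theorem[u ->].
apply/eqP/det0P; exists v => //.
rewrite mulrC rmorphM /= rmorphB /= horner_mx_X horner_mx_C.
by rewrite -mulmxE mulmxA mulmxBr vA mul_mx_scalar subrr mul0mx.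
Qed.

Lemma tr_delta_mul (F : fieldType) n' (Q R : 'M[F]_n') i :
  \tr (delta_mx i i *m Q *m delta_mx i i *m R) = Q i i * R i i.
Proof.
have E (Z : 'M[F]_n') :
    delta_mx (ord0 : 'I_1) i *m Z *m delta_mx i (ord0 : 'I_1) = (Z i i)%:M.
  by rewrite -rowE -colE; apply/matrixP => j k; rewrite !ord1 !mxE.
rewrite -(mul_delta_mx (ord0 : 'I_1)) -!mulmxA mxtrace_mulC !mulmxA E.
rewrite -!mulmxA (mulmxA _ R) E mxtrace_mulC mul_scalar_mx mxtraceZ.
by rewrite mxtrace_scalar mulr1n mulrC.
Qed.

(** Conjugation by P turns the adjugate at an eigenvalue d_i into a multiple of
    the matrix unit of index (i, i). *)
Lemma tr_adj_conj_diag (F : fieldType) n' (P : 'M[F]_n') (d : 'rV[F]_n') i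
    (M := \adj ((d 0 i)%:M - P *m diag_mx d *m invmx P)) :
    P \in unitmx -> injective (d 0) ->
  \tr (M *m M^T) = (invmx P *m M *m P) i i ^+ 2 *
    ((invmx P *m (invmx P)^T) i i * (P^T *m P) i i).
Proof.
move=> Pu dinj; pose B := (d 0 i)%:M - P *m diag_mx d *m invmx P.
pose D := diag_mx (\row_j (d 0 i - d 0 j)).
have BE : B = P *m D *m invmx P.
  have -> : D = (d 0 i)%:M - diag_mx d.
    rewrite -diag_const_mx -linearB; congr diag_mx.
    by apply/rowP => j; rewrite !mxE.
  by rewrite mulmxBr mulmxBl scalar_mxC mulmxK.
have detB : \det B = 0.
  rewrite BE !det_mulmx det_diag.
  by rewrite (bigD1 i)//= !mxE subrr mul0r mulr0 mul0r.
pose N := invmx P *m M *m P.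
have ME : M = P *m N *m invmx P by rewrite !mulmxA mulmxV// mul1mx mulmxK.
have ND : N *m D = 0.
  have : M *m B = 0 by rewrite mul_adj_mx detB raddf0.
  rewrite ME BE !mulmxA mulmxKV// => H.
  have := congr1 (fun Z => invmx P *m Z *m P) H.
  by rewrite mulmx0 mul0mx !mulmxA mulVmx// mul1mx mulmxKV.
have DN : D *m N = 0.
  have : B *m M = 0 by rewrite mul_mx_adj detB raddf0.
  rewrite ME BE !mulmxA mulmxKV// => H.
  have := congr1 (fun Z => invmx P *m Z *m P) H.
  by rewrite mulmx0 mul0mx !mulmxA mulVmx// mul1mx mulmxKV.
have dne j : j != i -> d 0 i - d 0 j != 0.
  by rewrite subr_eq0; apply: contra => /eqP/dinj->.
(* [N] is annihilated on both sides by [D], whose only zero entry on the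
   diagonal is the one of index [i]. *)
have NE : N = N i i *: delta_mx i i.
  apply/matrixP => j k; rewrite !mxE.
  have [->|ji] := eqVneq j i; last first.
    rewrite mulr0; apply/(mulfI (dne _ ji)); rewrite mulr0.
    by have := congr1 (fun Z : 'M[F]_n' => Z j k) DN; rewrite mul_diag_mx !mxE.
  have [->|ki] := eqVneq k i; first by rewrite mulr1.
  rewrite mulr0; apply/(mulIf (dne _ ki)); rewrite mul0r.
  by have := congr1 (fun Z : 'M[F]_n' => Z i k) ND; rewrite mul_mx_diag !mxE.
rewrite -/N.
have -> : M *m M^T = P *m (N *m (invmx P *m (invmx P)^T) *m N^T) *m P^T.
  by rewrite {1 2}ME !trmx_mul !mulmxA.
have NT : N^T = N i i *: delta_mx i i by rewrite {1}NE linearZ /= trmx_delta.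
set Q := invmx P *m _; rewrite NT {1}NE.
rewrite mxtrace_mulC mulmxA mxtrace_mulC -!scalemxAl -scalemxAr -scalemxAl.
by rewrite !mxtraceZ tr_delta_mul mulrA expr2.
Qed.

Lemma horner_tr_adj (R : comNzRingType) n' (A : 'M[R]_n') a
    (adjA := \adj (char_poly_mx A)) (M := \adj (a%:M - A)) :
  (\tr (adjA *m adjA^T)).[a] = \tr (M *m M^T).
Proof.
rewrite -[_.[_]]/(horner_eval a _) -trace_map_mx map_mxM -map_trmx map_mx_adj.
have -> // : map_mx (horner_eval a) (char_poly_mx A) = a%:M - A.
rewrite /char_poly_mx map_mxB map_scalar_mx /= /horner_eval hornerX.
by congr (_ - _); apply/matrixP => j k; rewrite !mxE hornerC.
Qed.

Section Witness.
Variable C : numClosedFieldType.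

(** The factor (char_poly A)^`() makes the eigenvalues simple, hence A
    diagonalizable, and the trace factor makes the eigenvectors
    nonisotropic. *)
Lemma eigen_discr_neq0 n' (A : 'M[C]_n'.+1) :
  eigen_discr A != 0 -> nonisotropic A.
Proof.
rewrite eigen_discr.unlock /=; set f := _ * \tr _.
rewrite mulf_eq0 negb_or => /andP[dA df].
have fn0 a : root (char_poly A) a -> ~~ root f a.
  move=> ra; apply: contra df => rf.
  by apply/eqP/(det_horner_common_root ra rf).
have [rs rsE] := closed_field_poly_normal (char_poly A).
move: rsE; rewrite (monicP (char_poly_monic A)) scale1r => rsE.
have sepA : separable_poly (char_poly A).
  rewrite unlock; apply/Pdiv.ClosedField.coprimepP => a /fn0.
  by rewrite /root hornerM mulf_eq0 negb_or => /andP[].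
have : diagonalizable A.
  apply/diagonalizableP; exists rs; last by rewrite -rsE mxminpoly_dvd_char.
  by rewrite -separable_prod_XsubC -rsE.
move=> [P Pu /(diagonalizable_forLR Pu)[d]].
rewrite mxpoly.conjumx ?unitmx_inv// => AE.
have {Pu AE} [P' [Pu AE]] : exists P', P' \in unitmx /\
  A = P' *m diag_mx d *m invmx P' by exists (invmx P); rewrite unitmx_inv.
have chi : char_poly A = \prod_i ('X - (d 0 i)%:P).
  rewrite AE char_poly_conj// char_poly_trig ?diag_mx_is_trig//.
  by apply: eq_bigr => i _; rewrite mxE eqxx.
have dinj : injective (d 0).
  apply/injectiveP; rewrite /injectiveb /dinjectiveb -separable_prod_XsubC.
  by rewrite big_map big_enum /= -chi.
have chid i : root (char_poly A) (d 0 i).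
  rewrite /root chi horner_prod prodf_seq_eq0; apply/hasP; exists i;
    by rewrite ?mem_index_enum//= !hornerE subrr.
have key i : ((P'^T *m P') i i != 0) && ((invmx P' *m (invmx P')^T) i i != 0).
  have := fn0 _ (chid i).
  rewrite /root hornerM mulf_eq0 negb_or => /andP[_].
  rewrite horner_tr_adj AE tr_adj_conj_diag// !mulf_eq0 !negb_or.
  by case/and3P=> _ -> ->.
exists P', d; split=> //.
- move=> i; apply: contra dA => /eqP di; rewrite AE !det_mulmx det_diag.
  by rewrite (bigD1 i)//= di mul0r mulr0 mul0r.
- by move=> i; case/andP: (key i).
- by move=> i; case/andP: (key i).
Qed.

Lemma eigen_discr_diag_neq0 n' (d : 'rV[C]_n'.+1) :
  injective (d 0) -> (forall i, d 0 i != 0) -> eigen_discr (diag_mx d) != 0.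
Proof.
move=> dinj d0; rewrite eigen_discr.unlock /=; set f := _ * \tr _.
rewrite horner_mx_diag !det_diag mulf_neq0//; first by apply/prodf_neq0.
apply/prodf_neq0 => i _; rewrite mxE /f hornerM mulf_neq0//.
  have chi : char_poly (diag_mx d) = \prod_(x <- [seq d 0 i | i]) ('X - x%:P).
    rewrite char_poly_trig ?diag_mx_is_trig// big_map big_enum /=.
    by apply: eq_bigr => j _; rewrite mxE eqxx.
  have : separable_poly (char_poly (diag_mx d)).
    by rewrite chi separable_prod_XsubC map_inj_uniq// enum_uniq.
  rewrite unlock => /Pdiv.ClosedField.coprimepP; apply.
  by rewrite chi root_prod_XsubC; apply/mapP; exists i; rewrite ?mem_enum.
rewrite horner_tr_adj.
have := tr_adj_conj_diag i (unitmx1 C n'.+1) dinj.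
rewrite !mulmx1 !mul1mx invmx1 !mulmx1 !mul1mx trmx1 => ->.
rewrite [1%:M _ _]mxE eqxx !mulr1 expf_neq0// mxE /cofactor
   mulf_neq0 ?signr_eq0//.
have -> : (d 0 i)%:M - diag_mx d = diag_mx (\row_j (d 0 i - d 0 j)).
  rewrite -diag_const_mx -linearB; congr diag_mx.
  by apply/rowP => j; rewrite !mxE.
have -> : row' i (col' i (diag_mx (\row_j (d 0 i - d 0 j))))
   = diag_mx (\row_j (d 0 i - d 0 (lift i j))).
  by apply/matrixP => j k; rewrite !mxE (inj_eq lift_inj).
rewrite det_diag; apply/prodf_neq0 => j _.
by rewrite mxE subr_eq0 (inj_eq dinj) neq_lift.
Qed.

Definition ramp n : 'M[C]_n := diag_mx (\row_i i.+1%:R).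

Lemma eigen_discr_ramp n' : eigen_discr (ramp n'.+1) != 0.
Proof.
apply: eigen_discr_diag_neq0 => [i j|i]; rewrite !mxE ?pnatr_eq0//.
by move/eqP; rewrite eqr_nat eqSS => /eqP/val_inj.
Qed.

End Witness.

(** * Lines of matrices and density *)

Section Density.
Variable C : numClosedFieldType.

Definition mxline n (A B : 'M[C]_n) : 'M[{poly C}]_n :=
  map_mx polyC A + 'X *: map_mx polyC (B - A).

Lemma horner_mxline n (A B : 'M[C]_n) t :
  map_mx (horner_eval t) (mxline A B) = A + t *: (B - A).
Proof.
by apply/matrixP => i j; rewrite !mxE /horner_eval !hornerE.
Qed.

Lemma horner_eigen_discr n' (L : 'M[{poly C}]_n'.+1) t :
  (eigen_discr L).[t] = eigen_discr (map_mx (horner_eval t) L).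
Proof. by rewrite map_eigen_discr. Qed.

Lemma eigen_discr_poly_neq0 n' (L : 'M[{poly C}]_n'.+1) t :
  eigen_discr (map_mx (horner_eval t) L) != 0 -> eigen_discr L != 0.
Proof. by apply: contraNneq => L0; rewrite -horner_eigen_discr L0 horner0. Qed.

(** A matrix B is sought such that both A B and B have a nonzero
    [eigen_discr].  On the line from A^-1 W to W the first condition holds at
    the origin and the second one at the other end, so that both hold at some
    point. *)
Lemma unitmx_mu0_4 n' (A : 'M[C]_n'.+1) : (3 <= n'.+1)%N -> A \in unitmx ->
  mu0 4 (traceless_symmetric C n'.+1) A.
Proof.
move=> n3 Au; pose W := ramp C n'.+1.
pose L := mxline (invmx A *m W) W; pose AL := map_mx polyC A *m L.
have L0 : eigen_discr L != 0.
  apply: (@eigen_discr_poly_neq0 _ _ 1).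
  by rewrite horner_mxline scale1r addrC subrK eigen_discr_ramp.
have evAL t : map_mx (horner_eval t) AL = A *m map_mx (horner_eval t) L.
  rewrite map_mxM; congr (_ *m _).
  by apply/matrixP => i j; rewrite !mxE /= /horner_eval hornerC.
have AL0 : eigen_discr AL != 0.
  apply: (@eigen_discr_poly_neq0 _ _ 0).
  by rewrite evAL horner_mxline scale0r addr0 mulKVmx// eigen_discr_ramp.
have [t] := poly_nonroot (mulf_neq0 AL0 L0).
rewrite hornerM mulf_eq0 negb_or.
rewrite (horner_eigen_discr AL) evAL (horner_eigen_discr L) => /andP[].
move: (map_mx _ L) => B dAB dB.
have Bu : B \in unitmx.
  by move: dB; rewrite eigen_discr.unlock /= mulf_eq0 negb_or unitmxE unitfE;
    case/andP.
rewrite -(mulmxK Bu A); apply: (@mu0_mul _ _ 2 2);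
  apply: nonisotropic_mu0_2 => //.
  exact: eigen_discr_neq0.
exact/nonisotropic_inv/eigen_discr_neq0.
Qed.

Lemma horner_mmap k (p : {mpoly C[k]}) (v : 'I_k -> {poly C}) t :
  (mmap polyC v p).[t] = p.@[fun i => (v i).[t]].
Proof.
rewrite /meval /mmap horner_sum; apply: eq_bigr => m _ /=.
rewrite hornerM hornerC /mmap1 horner_prod; congr (_ * _).
by apply: eq_bigr => i _; rewrite horner_exp.
Qed.

(** On the line from A to a diagonal matrix where [eigen_discr] is nonzero, a
    polynomial vanishing on the products has infinitely many zeros, so it
    vanishes at A. *)
Lemma mu_2_full n' : (3 <= n'.+1)%N ->
  mu 2 (traceless_symmetric C n'.+1) = setT.
Proof.
move=> n3; apply/seteqP; split=> // A _ Z [I ->] sub p Ip.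
pose L := mxline A (ramp C n'.+1).
pose q := mmap polyC (fun k => mxvec L 0 k) p.
have qE t : q.[t] = p.@[fun k => mxvec (map_mx (horner_eval t) L) 0 k].
  by rewrite horner_mmap -map_mxvec; apply: meval_eq => k; rewrite mxE.
have L0 : eigen_discr L != 0.
  apply: (@eigen_discr_poly_neq0 _ _ 1).
  by rewrite horner_mxline scale1r addrC subrK eigen_discr_ramp.
suff q0 : q = 0 by have := qE 0; rewrite q0 horner0 horner_mxline scale0r addr0.
apply/eqP/negP => /negP q0; have [t] := poly_nonroot (mulf_neq0 q0 L0).
rewrite hornerM mulf_eq0 negb_or horner_eigen_discr.
move=> /andP[/negP qt /eigen_discr_neq0/(nonisotropic_mu0_2 n3)/sub H].
by apply: qt; rewrite qE H.
Qed.

Lemma mu_1_proper n : (0 < n)%N -> mu 1 (traceless_symmetric C n) <> setT.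
Proof.
move=> n0 E.
pose p : {mpoly C[n * n]} := \sum_i 'X_(mxvec_index i i).
have pE A : p.@[fun k => mxvec A 0 k] = \tr A.
  rewrite raddf_sum; apply: eq_bigr => i _ /=.
  by rewrite mevalXU mxvecE.
have : mu 1 (traceless_symmetric C n) 1%:M by rewrite E.
have clp : zariski_closed (zero_locus [set p]%classic).
  by exists [set p]%classic.
move=> /(_ _ clp) H; have : (1%:M : 'M[C]_n) \in zero_locus [set p]%classic.
  rewrite inE; apply: H => _ [M XM ->] _ ->.
  by rewrite big_ord1 pE; case: (XM ord0).
rewrite inE => /(_ p erefl)/eqP.
by rewrite pE mxtrace1 pnatr_eq0 => /eqP n00; rewrite n00 in n0.
Qed.

End Density.

(** * Ranks of traceless symmetric matrices *)

(** For r <> 1 a diagonal matrix works, since 1 - r is nonzero.  A diagonal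
    matrix of rank 1 has nonzero trace; the rank 1 example is v v^T with v
    isotropic. *)
Lemma traceless_symmetric_rank (C : numClosedFieldType) n' r :
    (2 <= n'.+1)%N -> (r <= n'.+1)%N ->
  exists2 M, traceless_symmetric C n'.+1 M & \rank M = r.
Proof.
case: n' => [|n']// _ rn.
have [r1|r1] := eqVneq r 1.
  (* The isotropic vector (1, i, 0, ..., 0). *)
  pose v : 'cV[C]_n'.+2 := delta_mx ord0 0 + 'i *: delta_mx (lift ord0 ord0) 0.
  exists (v *m v^T).
    split; first by rewrite trmx_mul trmxK.
    rewrite mxtrace_mulC trace_mx11 mxE !big_ord_recl big1 => [|i _].
      by rewrite !mxE /= !mulr0 !addr0 add0r !mulr1 mulCii subrr.
    by rewrite !mxE /= !mulr0 addr0 mul0r.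
  apply/eqP; rewrite r1 eqn_leq; apply/andP; split.
    exact: leq_trans (mxrankM_maxl _ _) (rank_leq_col _).
  rewrite lt0n mxrank_eq0; apply/eqP => /matrixP/(_ ord0 ord0).
  rewrite !mxE big_ord1 !mxE /= mulr0 addr0 mulr1 => /eqP.
  by rewrite oner_eq0.
(* The first [r] entries on the diagonal are 1 - r, 1, ..., 1. *)
pose e : 'rV[C]_n'.+2 := \row_i (1 - if i == ord0 then r%:R else 0).
have eu : diag_mx e \in unitmx.
  rewrite unitmxE unitfE det_diag; apply/prodf_neq0 => i _; rewrite mxE.
  case: (i =P ord0) => _; last by rewrite subr0 oner_eq0.
  by rewrite subr_eq0 eq_sym (eqr_nat C r 1).
exists (pid_mx r *m diag_mx e); last first.
  by rewrite mxrankMfree ?row_free_unit// rank_pid_mx.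
split.
  apply/matrixP => i j; rewrite !mul_mx_diag !mxE eq_sym.
  by case: (i =P j :> nat) => [/val_inj->|_] //=; rewrite !mul0r.
transitivity (
  \sum_(i < n'.+2) ((i < r)%N%:R - if i == ord0 then r%:R else 0) : C).
  apply: eq_bigr => i _; rewrite mul_mx_diag !mxE eqxx /=.
  rewrite mulrBr mulr1; case: eqVneq => [->|]; last by rewrite mulr0.
  by case: r {rn r1 e eu} => [|r]; rewrite ?mulr0// mul1r.
rewrite sumrB -big_mkcond big_pred1_eq -natr_sum -big_mkcond /=.
by rewrite -(big_ord_widen _ (fun=> 1%N))// sum_nat_const card_ord muln1 subrr.
Qed.

Lemma same_rank_equiv (F : fieldType) m n (A B : 'M[F]_(m, n)) :
  \rank A = \rank B ->
  exists P Q, [/\ P \in unitmx, Q \in unitmx & A = P *m B *m Q].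
Proof.
move=> rAB; exists (col_ebase A *m invmx (col_ebase B)).
exists (invmx (row_ebase B) *m row_ebase A); split.
- by rewrite unitmx_mul unitmx_inv !col_ebase_unit.
- by rewrite unitmx_mul unitmx_inv !row_ebase_unit.
rewrite -{1}(mulmx_ebase A) -{2}(mulmx_ebase B) rAB !mulmxA.
by rewrite mulmxKV ?col_ebase_unit// mulmxK ?row_ebase_unit.
Qed.

Lemma mu0_9_full (C : numClosedFieldType) n' : (3 <= n'.+1)%N ->
  mu0 9 (traceless_symmetric C n'.+1) = setT.
Proof.
move=> n3; apply/seteqP; split=> // A _.
have [M XM rM] := traceless_symmetric_rank C (ltnW n3) (rank_leq_row A).
have [P [Q [Pu Qu ->]]] := same_rank_equiv (esym rM).
apply: (@mu0_mul _ _ 5 4); last exact: unitmx_mu0_4.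
by apply: (@mu0_mul _ _ 4 1); [exact: unitmx_mu0_4 | exact: mu0_1].
Qed.

Lemma is_minimum_exists (S : set nat) k :
  S k -> exists2 l, is_minimum S l & (l <= k)%N.
Proof.
move=> Sk; have exS : exists k, `[< S k >] by exists k; apply/asboolP.
case: (ex_minnP exS) => l /asboolP Sl lmin; exists l; last exact/lmin/asboolP.
by split=> // r Sr; exact/lmin/asboolP.
Qed.

Theorem theorem5p1 (R : realType) (n : nat) (hn : (3 <= n)%N) :
  is_FL_gen (traceless_symmetric R[i] n) 2 /\
  (exists2 l : nat, is_FL_max (traceless_symmetric R[i] n) l & (l <= 10)%N).
Proof.
case: n hn => // n hn; split.
  split; first by split=> //; exact: mu_2_full.
  by case=> [|[|r]] [] // _ /mu_1_proper; case.
have [] := @is_minimum_exists [set r | (1 <= r)%N /\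
  mu0 r (traceless_symmetric R[i] n.+1) = setT]%classic 9.
  by split=> //; exact: mu0_9_full.
by move=> l lmin l9; exists l => //; exact: leq_trans l9 _.
Qed.
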